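(* Let $L$ be the multiplicity array of $B=B^{r_k,s_k}\otimes\cdots\otimes B^{r_1,s_1}$ and let $\lambda=(\lambda_1,\ldots,\lambda_n)$ be an $n$-tuple of nonnegative integers. Let $\mathcal{SA}(\lambda')$ be the set of all nonempty subsets of $\mathcal{A}(\lambda')$ and, for $S\in\mathcal{SA}(\lambda')$, put $M_i^{(a)}(S)=\max\{M_i^{(a)}(t)\mid t\in S\}$. Then the RC polynomial $M(L,\lambda)=\sum_{(\nu,J)\in\mathrm{RC}(L,\lambda)}q^{cc(\nu,J)}$ is given by $$M(L,\lambda)=\sum_{S\in\mathcal{SA}(\lambda')}(-1)^{|S|+1}\sum_{\nu\in\mathrm{C}(L,\lambda)}q^{cc(\nu)+\sum_{(a,i)\in\mathcal{H}}m_i^{(a)}M_i^{(a)}(S)}\prod_{(a,i)\in\mathcal{H}}\genfrac{[}{]}{0pt}{}{m_i^{(a)}+p_i^{(a)}-M_i^{(a)}(S)}{m_i^{(a)}}.$$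
   Context: Fix an integer $n\ge 2$, let $I=\{1,2,\ldots,n-1\}$ and $\mathcal{H}=I\times\mathbb{Z}_{>0}$. The multiplicity array of $B=B^{r_k,s_k}\otimes\cdots\otimes B^{r_1,s_1}$ (with $r_j\in I$, $s_j\ge1$) is $L=(L_i^{(a)}\mid (a,i)\in\mathcal{H})$, with $L_i^{(a)}$ the number of factors $B^{a,i}$ in $B$. Let $\epsilon_1,\ldots,\epsilon_n$ be the standard basis of $\mathbb{Z}^n$, $\alpha_a=\epsilon_a-\epsilon_{a+1}$, $\Lambda_a=\epsilon_1+\cdots+\epsilon_a$, and let $(\alpha_a|\alpha_b)$ be the Cartan matrix of type $A_{n-1}$. An $(L,\lambda)$-configuration is a sequence of partitions $\nu=(\nu^{(a)})_{a\in I}$ with $$\sum_{(a,i)\in\mathcal{H}} i\,m_i^{(a)}\alpha_a=\sum_{(a,i)\in\mathcal{H}} i\,L_i^{(a)}\Lambda_a-\lambda,$$ where $m_i^{(a)}$ is the number of parts of length $i$ in $\nu^{(a)}$; $\mathrm{C}(L,\lambda)$ is the set of these. The vacancy numbers are $$p_i^{(a)}=\sum_{j\ge1}\min(i,j)L_j^{(a)}-\sum_{(b,j)\in\mathcal{H}}(\alpha_a|\alpha_b)\min(i,j)m_j^{(b)}.$$ Put $c_k=\lambda_{k+1}+\cdots+\lambda_n$ for $k\ge1$ and $c_0=c_1$ (so $c_n=0$). Let $\lambda'$ be the partition whose $k$-th column has height $c_k$, $1\le k\le n-1$. $\mathcal{A}(\lambda')$ is the set of fillings $t$ of the shape $\lambda'$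 such that the entries of column $k$ lie in $\{1,2,\ldots,c_{k-1}\}$ and strictly decrease down each column; $t_{j,k}$ is the entry in row $j$, column $k$. With $\chi(S)=1$ if $S$ is true and $0$ otherwise, set $$M_i^{(a)}(t)=-\sum_{j=1}^{c_a}\chi(i\ge t_{j,a})+\sum_{j=1}^{c_{a+1}}\chi(i\ge t_{j,a+1}).$$ For $M,p,m\in\mathbb{Z}$, $m\ge0$, an $(M,p,m)$-quasipartition is a tuple of integers $(\mu_1,\ldots,\mu_m)$ with $M\le\mu_m\le\cdots\le\mu_1\le p$ (for $m=0$: the empty tuple, with no condition). $\mathrm{RC}(L,\lambda)$ is the set of pairs $(\nu,J)$ with $\nu\in\mathrm{C}(L,\lambda)$ and $J=(J^{(a,i)})_{(a,i)\in\mathcal{H}}$ such that for some $t\in\mathcal{A}(\lambda')$ (the same $t$ for all $(a,i)$) each $J^{(a,i)}$ is an $(M_i^{(a)}(t),p_i^{(a)},m_i^{(a)})$-quasipartition. The cocharge is $cc(\nu,J)=cc(\nu)+\sum_{(a,i)\in\mathcal{H}}|J^{(a,i)}|$, where $|J^{(a,i)}|$ is the sum of the parts and $cc(\nu)=\frac12\sum_{a,b\in I}\sum_{j,k\ge1}(\alpha_a|\alpha_b)\min(j,k)m_j^{(a)}m_k^{(b)}$. The $q$-binomial coefficient is $\genfrac{[}{]}{0pt}{}{m+p}{m}=\frac{(q)_{m+p}}{(q)_m(q)_p}$ with $(q)_n=(1-q)(1-q^2)\cdots(1-q^n)$, for $m,p\ge0$; it is the generating function of partitions with at most $m$ parts each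 not exceeding $p$. For $p<0$ it is interpreted as $1$ if $m=0$ and as $0$ if $m>0$. *)

(* Defs.v *)
From HB Require Import structures.
From mathcomp Require Import all_boot all_order all_algebra.
From mathcomp Require Import all_classical.
From mathcomp Require Import zify.

Set Implicit Arguments.
Unset Strict Implicit.
Unset Printing Implicit Defensive.

Import Order.TTheory GRing.Theory Num.Theory.
Local Open Scope ring_scope.

(* The infinite sums and products over j >= 1 and over H below are the
   finite-support iterations of [fsbigop]; every one of them has only finitely
   many terms different from the neutral element. The sums over [C] and [RC] are
   written in the same way; lemmas [C_finite] and [RC_finite] show that these
   sets are finite. *)

Definition posnat := {i : nat | (0 < i)%N}.

HB.instance Definition _ := Choice.on posnat.

Definition nat_of_posnat (i : posnat) : nat := \val i.
Coercion nat_of_posnat : posnat >-> nat.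

(* I = {1, ..., n-1} is represented by 'I_n.-1: the ordinal a stands for
   a.+1. *)
Definition H (n : nat) := ('I_n.-1 * posnat)%type.

HB.instance Definition _ (n : nat) := Choice.on (H n).

(* A tensor product B^{r_k,s_k} (x) ... (x) B^{r_1,s_1} enters only through the
   pairs (r_j, s_j). *)
Definition multiplicity_array (n : nat) (B : seq (H n)) : H n -> nat :=
  fun h => count_mem h B.

Section Weights.
Variable n : nat.

(* The index k of [eps] starts at 1; eps k = 0 unless 1 <= k <= n. *)
Definition eps (k : nat) : 'rV[int]_n := \row_(j < n) (j.+1 == k)%:Z.

Definition alpha (a : 'I_n.-1) : 'rV[int]_n := eps a.+1 - eps a.+2.

Definition Lambda (a : 'I_n.-1) : 'rV[int]_n :=
  \sum_(1 <= k < a.+2) eps k.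

Definition weight (lam : n.-tuple nat) : 'rV[int]_n :=
  \row_(j < n) (tnth lam j)%:Z.

Definition cartan (a b : 'I_n.-1) : int :=
  if a == b then 2
  else if (a.+1 == b :> nat) || (b.+1 == a :> nat) then -1 else 0.

End Weights.

Definition is_intpart (s : seq nat) : bool := sorted geq s && (0%N \notin s).

Section Configurations.
Variables (n : nat) (L : H n -> nat).

Definition configuration := {ffun 'I_n.-1 -> seq nat}.

(* m_i^(a) *)
Definition mult (nu : configuration) (h : H n) : nat :=
  count_mem (h.2 : nat) (nu h.1).

Definition C (lam : n.-tuple nat) : set configuration :=
  [set nu : configuration | (forall a, is_intpart (nu a)) /\
     \sum_(h \in [set: H n]) alpha h.1 *+ (h.2 * mult nu h)
     = \sum_(h \in [set: H n]) Lambda h.1 *+ (h.2 * L h) - weight lam]%classic.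

(* p_i^(a) *)
Definition vacancy (nu : configuration) (h : H n) : int :=
  \sum_(j \in [set: posnat]) (minn h.2 (j : posnat) * L (h.1, j))%:Z
  - \sum_(g \in [set: H n]) cartan h.1 g.1 * (minn h.2 g.2 * mult nu g)%:Z.

(* The double sum is even, so that the integer division is exact: see
   [cc_even]. *)
Definition cc (nu : configuration) : int :=
  ((\sum_(g \in [set: H n]) \sum_(h \in [set: H n])
      cartan g.1 h.1 * (minn g.2 h.2 * mult nu g * mult nu h)%:Z) %/ 2)%Z.

End Configurations.

Section Fillings.
Variables (n : nat) (lam : n.-tuple nat).

(* lambda_{k+1} + ... + lambda_n; since [tnth] counts from 0, lambda_{k+1} has
   index k. *)
Definition lam_tail (k : nat) : nat :=
  (\sum_(j < n | k <= j) tnth lam j)%N.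

Definition c (k : nat) : nat := if k is 0 then lam_tail 1 else lam_tail k.

(* The cell in column k and row j, where 1 <= k <= n-1 and 1 <= j <= c_k, is
   [Tagged _ j'] with tag k' : 'I_n.-1, where k = k'.+1 and j = j'.+1. *)
Definition cell := {k : 'I_n.-1 & 'I_(c k.+1)}.

Definition col (x : cell) : nat := (tag x).+1.
Definition row (x : cell) : nat := (tagged x).+1.

(* The entries of column k are at most c_{k-1} <= c_0, so taking them in
   'I_(c 0).+1 is no restriction; it makes the type of fillings finite. *)
Definition filling := {ffun cell -> 'I_(c 0).+1}.

Definition A : {set filling} :=
  [set t : filling |
     [forall x, 1 <= t x <= c (col x).-1] &&
     [forall x, forall y,
        (col x == col y) && (row x < row y) ==> (t y < t x)]]%N%SET.

Definition SA : {set {set filling}} :=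
  [set S : {set filling} | (S != finset.set0) && (S \subset A)]%SET.

(* The number of entries t_{j,k} of column k with i >= t_{j,k}; it is 0 for
   k = n, since column n has height c_n = 0. *)
Definition col_count (t : filling) (k i : nat) : nat :=
  (\sum_(x : cell | col x == k) (t x <= i)%N)%N.

(* M_i^(a)(t) *)
Definition Mt (t : filling) (h : H n) : int :=
  - (col_count t h.1.+1 h.2)%:Z + (col_count t h.1.+2 h.2)%:Z.

(* M_i^(a)(S), the maximum of M_i^(a)(t) over t in S; the starting value of the
   iterated maximum is that of an element of S. The value on the empty set is
   irrelevant. *)
Definition MS (S : {set filling}) (h : H n) : int :=
  if [pick t in S] is Some t0
  then \big[Num.max/Mt t0 h]_(t in S) Mt t h
  else 0.

End Fillings.

(* (M, p, m)-quasipartitions, listed as mu_1, ..., mu_m *)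
Definition quasipartition (M p : int) (m : nat) (mu : seq int) : Prop :=
  size mu = m /\
  ((0 < m)%N -> path (fun x y : int => y <= x) p (rcons mu M)).

Section RiggedConfigurations.
Variables (n : nat) (L : H n -> nat) (lam : n.-tuple nat).

Definition rigging := H n -> seq int.

Definition RC : set (configuration n * rigging) :=
  [set x : configuration n * rigging | C L lam x.1 /\
     exists2 t : filling lam, t \in A lam &
       forall h : H n,
         quasipartition (Mt t h) (vacancy L x.1 h) (mult x.1 h) (x.2 h)]%classic.

Definition ccJ (x : configuration n * rigging) : int :=
  cc x.1 + \sum_(h \in [set: H n]) \sum_(y <- x.2 h) y.

End RiggedConfigurations.

(* The field of fractions of Z[q], which contains Z[q, q^-1]; cocharges may be
   negative. *)
Definition Kq := {fraction {poly int}}.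

Definition q : Kq := tofrac ('X : {poly int}).

Definition qpoch (k : nat) : Kq := \prod_(1 <= i < k.+1) (1 - q ^+ i).

(* [m + p choose m]_q, for p of any sign *)
Definition qbinom (m : nat) (p : int) : Kq :=
  if p is Posz p' then qpoch (m + p') / (qpoch m * qpoch p')
  else (m == 0)%:R.

Definition RCpoly (n : nat) (L : H n -> nat) (lam : n.-tuple nat) : Kq :=
  \sum_(x \in RC L lam) q ^ ccJ x.

Lemma mult_finite n (nu : configuration n) :
  finite_set [set h : H n | mult nu h != 0%N]%classic.
Proof.
apply: (@sub_finite_set _ _ [set` [seq (a, i) | a <- enum 'I_n.-1, i <- pmap insub (nu a)]]%classic); last exact: finite_seq.
move=> [a i] /= Hm.
apply/allpairsPdep; exists a, i; split => //; first by rewrite mem_enum.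
rewrite mem_pmap_sub /= /in_mem /=.
by move: Hm; rewrite /mult /= -lt0n -has_count has_pred1.
Qed.

(* coordinate on alpha_a of a vector of the root lattice *)
Definition phi n (a : 'I_n.-1) (v : 'rV[int]_n) : int :=
  \sum_(j < n | (j <= a)%N) v 0 j.

Lemma phiD n (a : 'I_n.-1) : {morph phi a : u v / u + v >-> u + v}.
Proof. by move=> u v; rewrite /phi -big_split; apply: eq_bigr => j _; rewrite mxE. Qed.

Lemma phi0 n (a : 'I_n.-1) : phi a 0 = 0.
Proof. by rewrite /phi big1 // => j _; rewrite mxE. Qed.

Lemma phi_eps n (a : 'I_n.-1) k : phi a (eps n k) = ((0 < k) && (k <= a.+1))%N%:Z.
Proof.
have La := ltn_ord a.
rewrite /phi; under eq_bigr do rewrite mxE.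
case: k => [|k].
  by rewrite big1.
case: (leqP k.+1 a.+1) => /= Hk.
  have Hkn : (k < n)%N by lia.
  rewrite (bigD1 (Ordinal Hkn)) /=; last by lia.
  rewrite eqxx big1 ?addr0 // => j /andP[_ /negPf].
  by rewrite -val_eqE /= eqSS => ->.
rewrite big1 // => j Hj; case: eqP => // [[?]]; lia.
Qed.

Lemma phi_alpha n (a b : 'I_n.-1) : phi a (alpha b) = (a == b)%:Z.
Proof.
have -> : phi a (alpha b) = phi a (eps n b.+1) - phi a (eps n b.+2).
  have := phiD a (alpha b) (eps n b.+2); rewrite /alpha subrK => ->.
  by rewrite addrK.
rewrite !phi_eps /= -val_eqE /=; lia.
Qed.

Lemma phiMn n (a : 'I_n.-1) v m : phi a (v *+ m) = phi a v *+ m.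
Proof. by elim: m => [|m IH]; rewrite ?mulr0n ?phi0 // !mulrS phiD IH. Qed.

Lemma mult_bound n (L : H n -> nat) lam nu (h : H n) : C L lam nu ->
  (h.2 * mult nu h)%:Z <= phi h.1 (\sum_(g \in [set: H n]) Lambda g.1 *+ (g.2 * L g) - weight lam) \/ mult nu h = 0%N.
Proof.
move=> [_ <-]; have [/eqP|H0] := boolP (mult nu h == 0%N); [by right|left].
have F: finite_set ([set: H n] `&` (fun g : H n => alpha g.1 *+ (g.2 * mult nu g)) @^-1` [set~ 0])%classic.
  apply: sub_finite_set (mult_finite nu) => g /= [_ Hg]; apply/eqP => E; apply: Hg.
  by rewrite E muln0 mulr0n.
have G (g : H n) : phi h.1 (alpha g.1 *+ (g.2 * mult nu g)) = ((h.1 == g.1) * (g.2 * mult nu g))%N%:Z.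
  rewrite phiMn phi_alpha; lia.
rewrite (big_morph _ (phiD _) (phi0 _)).
under eq_bigr do rewrite G.
rewrite (bigD1_seq h) ?finite_support_uniq //=.
  rewrite eqxx mul1n lerDl; apply: sumr_ge0 => //.
rewrite in_finite_support // inE; split => //= E.
have := G h; rewrite E phi0 eqxx mul1n => /eqP; rewrite eq_sym eqz_nat muln_eq0 (negPf H0) orbF.
by case: h.2 => [[|i] Hi].
Qed.

Lemma C_finite n (L : H n -> nat) lam : finite_set (C L lam).
Proof.
set v := \sum_(g \in [set: H n]) Lambda g.1 *+ (g.2 * L g) - weight lam.
pose K := (\max_(a < n.-1) `|phi a v|)%N.
pose f (nu : configuration n) := [ffun x : 'I_n.-1 * 'I_K.+1 => inord (count_mem (x.2 : nat) (nu x.1)) : 'I_K.+1].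
have CB nu a (i : posnat) : C L lam nu -> (mult nu (a, i) <> 0)%N -> (i <= K)%N /\ (mult nu (a, i) <= K)%N.
  move=> /mult_bound-/(_ (a, i)) /=[|->] //; rewrite -/v => Hb M0.
  have : (i * mult nu (a, i) <= K)%N.
    rewrite /K; apply: leq_trans (leq_bigmax (F := fun a => `|phi a v|%N) a).
    by rewrite -lez_nat; apply: le_trans Hb _; rewrite abszE ler_norm.
  have Hi : (0 < i)%N by exact: (valP i).
  move=> Hk; split; nia.
have cnt0 nu a : C L lam nu -> count_mem 0%N (nu a) = 0%N.
  by move=> [/(_ a)/andP[_ /count_memPn]].
have Cb nu a (i : nat) : C L lam nu -> count_mem i (nu a) <> 0%N -> (i <= K)%N /\ (count_mem i (nu a) <= K)%N.
  move=> HC; case: i => [|i]; first by rewrite (cnt0 _ _ HC).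
  exact: (CB nu a (exist _ i.+1 isT) HC).
have inj : set_inj (C L lam) f.
  move=> nu nu'; rewrite !inE => HC HC' E; apply/ffunP => a.
  apply: (@sorted_eq _ geq).
  - by move=> x y z /=; lia.
  - by move=> x y /=; lia.
  - by case: HC => /(_ a)/andP[].
  - by case: HC' => /(_ a)/andP[].
  apply/allP => i _ /=; apply/eqP.
  have [Hi|Hi] := leqP i K; last first.
    have Z mu : C L lam mu -> count_mem i (mu a) = 0%N.
      by move=> Hm; case: (count_mem i (mu a) =P 0%N) => // /(Cb _ _ _ Hm) []; lia.
    by rewrite !Z.
  have L' mu : C L lam mu -> (count_mem i (mu a) < K.+1)%N.
    by move=> Hm; case: (count_mem i (mu a) =P 0%N) => [->//|/(Cb _ _ _ Hm) []].
  have /ffunP/(_ (a, Ordinal (Hi : (i < K.+1)%N))) := E.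
  by rewrite !ffunE /= => /(congr1 val); rewrite /= !inordK ?L'.
by rewrite -(eq_finite_set (inj_card_eq inj)); exact: finite_finset.
Qed.

Lemma finite_map (T : Type) (U : Type) (Q : T -> set U) (s : seq T) :
  (forall x, finite_set (Q x)) ->
  finite_set [set l | exists2 f : T -> U, (forall x, Q x (f x)) & l = map f s]%classic.
Proof.
move=> FQ; elim: s => [|x s IH].
  by apply: sub_finite_set (finite_set1 [::]) => l [f _ ->].
apply: sub_finite_set (finite_image2 cons (FQ x) IH) => l [f Hf ->] /=.
by exists (f x) => //; exists (map f s) => //; exists f.
Qed.

Lemma quasi_finite M p m : finite_set [set mu | quasipartition M p m mu]%classic.
Proof.
pose s := [seq M + i%:Z | i <- iota 0 `|p - M|.+1].
apply: sub_finite_set (finite_map (iota 0 m) (fun _ : nat => finite_seq (0 :: s))) => mu /= [sz Hp].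
exists (nth 0 mu); last by rewrite -sz map_nth_iota0 ?take_size.
move=> i /=; rewrite inE; have [Hi|Hi] := ltnP i (size mu); last by rewrite nth_default ?eqxx.
have m0 : (0 < m)%N by rewrite -sz; exact: leq_ltn_trans (leq0n _) Hi.
have tr : transitive (fun x y : int => y <= x) by move=> x y z /= a b; exact: le_trans b a.
have := Hp m0; rewrite -cats1 cat_path /= andbT => /andP[P1 P2].
have U : nth 0 mu i <= p.
  by move: P1; rewrite path_sortedE // => /andP[/allP/(_ _ (mem_nth 0 Hi))].
have B : M <= nth 0 mu i.
  have : sorted (fun x y : int => y <= x) (mu ++ [:: M]).
    by case: (mu) Hi (Hp m0) => // x l _; rewrite -cats1 /= => /andP[].
  rewrite sorted_pairwise // pairwise_cat allrel1r => /andP[/allP H _].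
  exact: H _ (mem_nth 0 Hi).
rewrite /s; move: (nth 0 mu i) U B => z U B; change int in z.
apply/orP; right; apply/mapP; exists `|z - M|%N; first by rewrite mem_iota; lia.
have E : z = M + `|z - M|%N%:Z by clear -B; lia.
exact: E.
Qed.

Lemma RC_finite n (L : H n -> nat) lam : finite_set (RC L lam).
Proof.
pose Q (nu : configuration n) (t : filling lam) :=
  [set J : rigging n | forall h, quasipartition (Mt t h) (vacancy L nu h) (mult nu h) (J h)]%classic.
have FQ nu t : finite_set (Q nu t).
  have /finite_seqP[s Es] := mult_finite nu.
  have inj : {in Q nu t &, injective (fun J : rigging n => map J s)}.
    move=> J J' /set_mem HJ /set_mem HJ' E; apply/funext => h.
    have [m0|m0] := eqVneq (mult nu h) 0%N.
      have Z K : Q nu t K -> K h = [::].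
        by move=> /(_ h)[]; rewrite m0 => /size0nil.
      by rewrite !Z.
    have hs : h \in s by have : [set` s]%classic h by rewrite -Es.
    by move/eq_in_map : E; apply.
  rewrite -(eq_finite_set (inj_card_eq inj)).
  apply: sub_finite_set (finite_map s (fun h => quasi_finite (Mt t h) (vacancy L nu h) (mult nu h))).
  by move=> l [J HJ <-]; exists J.
apply: (@sub_finite_set _ _ (\bigcup_(nu in C L lam) \bigcup_(t in [set: filling lam]) ([set nu] `*` Q nu t))%classic).
  by move=> [nu J] [HC [t _ HJ]]; exists nu => //; exists t.
apply: bigcup_finite; first exact: C_finite.
move=> nu _; apply: bigcup_finite; first exact: finite_finset.
by move=> t _; apply: finite_setX => //; exact: finite_set1.
Qed.

Lemma cc_even n (nu : configuration n) :
  (cc nu) * 2 = \sum_(g \in [set: H n]) \sum_(h \in [set: H n])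
      cartan g.1 h.1 * (minn g.2 h.2 * mult nu g * mult nu h)%:Z.
Proof.
apply: divzK.
have /finite_seqP[Y EY] := mult_finite nu.
pose X := undup Y.
have EX : [set h | mult nu h != 0%N]%classic = [set` X]%classic.
  by rewrite EY; apply/seteqP; split=> h /=; rewrite mem_undup.
set F := fun g h : H n => cartan g.1 h.1 * (minn g.2 h.2 * mult nu g * mult nu h)%:Z.
have W (f : H n -> int) : (forall h, mult nu h = 0%N -> f h = 0) ->
   \sum_(h \in [set: H n]) f h = \sum_(h <- X) f h.
  move=> Hf; rewrite [RHS]fsbig_seq ?undup_uniq //; apply/esym/fsbig_widen => // h [_ /= Hh].
  apply: Hf; case: (mult nu h =P 0%N) => // /eqP Hm; case: Hh.
  by have : [set` X]%classic h by rewrite -EX.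
have -> : \sum_(g \in [set: H n]) \sum_(h \in [set: H n]) F g h = \sum_(g <- X) \sum_(h <- X) F g h.
  rewrite W; last by move=> g m0; rewrite fsbig1 // => h _; rewrite /F m0 muln0 mul0n mulr0.
  by apply: eq_bigr => g _; rewrite W // => h m0; rewrite /F m0 muln0 mulr0.
have Fs g h : F g h = F h g.
  rewrite /F minnC /cartan (eq_sym g.1) orbC; congr (_ * _%:Z); lia.
have F2 g : (2 %| F g g)%Z by rewrite /F /cartan eqxx dvdz_mulr.
elim: {EX W} X => [|x s IH]; first by rewrite !big_nil.
rewrite !big_cons; under [X in _ + X]eq_bigr do rewrite big_cons.
rewrite big_split /=.
under [X in _ + (X + _)]eq_bigr do rewrite Fs.
rewrite addrA -(addrA (F x x)) -mulr2n.
apply: rpredD IH; apply: rpredD; first exact: F2. move: (\sum_(j <- s) F x j) => z.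
have -> : z *+ 2 = z * 2 by rewrite -mulr_natr.
exact: (dvdz_mull z (dvdzz 2)).
Qed.

(* Main.v *)
(** For a fixed configuration [nu], call [Q t] the set of riggings with lower
bounds [Mt t]. The rigged configurations over [nu] form the union of the [Q t],
[t] in [A], while the intersection of the [Q t] over a nonempty [S] is given by
the lower bounds [MS S], the maxima of the [Mt t]. The formula is therefore
inclusion-exclusion: the nonempty subsets [S] of the nonempty set of all [t] that
allow a given rigging contribute [sum (-1)^(|S|+1) = 1]. The generating function
of an intersection factors over [(a, i)], and each factor counts partitions in a
box, shifted by [MS S]. *)

Require Import Defs.
From HB Require Import structures.
From mathcomp Require Import all_boot all_order all_algebra.
From mathcomp Require Import finmap all_classical.
From mathcomp Require Import zify ring.

Set Implicit Arguments.
Unset Strict Implicit.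
Unset Printing Implicit Defensive.

Import Order.TTheory GRing.Theory Num.Theory.
Local Open Scope ring_scope.

(** * Gaussian binomials *)

Lemma q_neq0 : q != 0.
Proof. by rewrite tofrac_eq0 polyX_eq0. Qed.

Lemma subr1_qX_neq0 k : 1 - q ^+ k.+1 != 0.
Proof.
rewrite /q -tofracXn -tofrac1 -tofracB tofrac_eq0 subr_eq0 eq_sym.
by apply/eqP => /(congr1 (fun p : {poly int} => size p)); rewrite size_polyXn size_poly1.
Qed.

Lemma qpochS k : qpoch k.+1 = qpoch k * (1 - q ^+ k.+1).
Proof. by rewrite /qpoch big_nat_recr. Qed.

Lemma qpoch0 : qpoch 0 = 1.
Proof. by rewrite /qpoch big_nil. Qed.

Lemma qpoch_neq0 k : qpoch k != 0.
Proof.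
elim: k => [|k IH]; first by rewrite qpoch0 oner_neq0.
by rewrite qpochS; exact: mulf_neq0 IH (subr1_qX_neq0 k).
Qed.

Lemma qbinom0n (p : int) : qbinom 0 p = 1.
Proof. by case: p => // p; rewrite /qbinom add0n qpoch0 mul1r divff ?qpoch_neq0. Qed.

Lemma qbinomn0 m : qbinom m 0%:Z = 1.
Proof. by rewrite /qbinom addn0 qpoch0 mulr1 divff ?qpoch_neq0. Qed.

(** The $q$-Pascal rule in free variables, so that [field] applies: [a], [b], [c] stand for $(q)_m$,
    $(q)_p$, $(q)_{m+p}$, then [x] $=q^{m+1}$, [y] $=q^{p+1}$, [z] $=1-q^{m+p+1}$. *)
Lemma qbinomSS_identity (K : fieldType) (a b x y c z : K) :
  a != 0 -> b != 0 -> 1 - x != 0 -> 1 - y != 0 ->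
  c * z * (1 - x * y) / (a * (1 - x) * (b * (1 - y)))
  = c * z / (a * (1 - x) * b) + y * (c * z / (a * (b * (1 - y)))).
Proof. by move=> a0 b0 x0 y0; field; rewrite a0 b0 x0 y0. Qed.

Lemma qbinomSS m p :
  qbinom m.+1 p.+1%:Z = qbinom m.+1 p%:Z + q ^+ p.+1 * qbinom m p.+1%:Z.
Proof.
rewrite /qbinom !addnS !addSn !qpochS.
have -> : q ^+ (m + p).+2 = q ^+ m.+1 * q ^+ p.+1 by rewrite -exprD addSn addnS.
move: (qpoch_neq0 m) (qpoch_neq0 p) (subr1_qX_neq0 m) (subr1_qX_neq0 p).
exact: qbinomSS_identity.
Qed.

(** In terms of partitions in a box, [i] is the largest part; [box] below recurses in the same
    way. *)
Lemma sum_qbinom m p :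
  \sum_(0 <= i < p.+1) q ^+ i * qbinom m i%:Z = qbinom m.+1 p%:Z.
Proof.
elim: p => [|p IH]; first by rewrite big_nat1 mul1r !qbinomn0.
by rewrite big_nat_recr //= IH -qbinomSS.
Qed.

(** * Enumeration of quasipartitions *)

Lemma path_ge_last (y : int) s :
  path (fun x z : int => z <= x) y s -> last y s <= y.
Proof. by elim: s y => //= x s IH y /andP[xy /IH /le_trans]; apply. Qed.

(** Quasipartitions with bounds [M] and [M + p]: the head is the largest part, and its offset [i]
    from [M] is the upper bound for the remaining parts. *)
Fixpoint box (M : int) (m p : nat) : seq (seq int) :=
  if m is m'.+1
  then [seq M + i%:Z :: mu | i <- index_iota 0 p.+1, mu <- box M m' i]
  else [:: [::]].

Lemma boxS M m p :
  box M m.+1 p = [seq M + i%:Z :: mu | i <- index_iota 0 p.+1, mu <- box M m i].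
Proof. by []. Qed.

Lemma box_uniq M m p : uniq (box M m p).
Proof.
elim: m p => // m IH p; apply: allpairs_uniq_dep; rewrite ?iota_uniq //.
by move=> [i mu] [j nu] _ _ [/addrI [->] ->].
Qed.

Lemma mem_box M m p mu :
  mu \in box M m p
  = (size mu == m) && path (fun x y : int => y <= x) (M + p%:Z) (rcons mu M).
Proof.
elim: m p mu => [|m IH] p mu.
  by case: mu => [|y mu] /=; rewrite inE ?lerDl.
rewrite boxS; apply/allpairsPdep/idP => [[i [nu [Hi Hnu ->]]]|].
  move: Hi Hnu; rewrite mem_index_iota IH /= eqSS => Hi /andP[-> ->].
  by rewrite lerD2l lez_nat andbT.
case: mu => //= y mu; rewrite eqSS.
case/and3P=> Hs yp Hp.
have My : M <= y.
  by move: Hp; rewrite rcons_path => /andP[/path_ge_last H1 H2]; exact: le_trans H2 H1.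
have E : y = M + `|y - M|%N%:Z by lia.
exists `|y - M|%N, mu; split; last by rewrite -E.
  by rewrite mem_index_iota /=; lia.
by rewrite IH Hs -E.
Qed.

Lemma sum_box M m p :
  \sum_(mu <- box M m p) q ^ (\sum_(y <- mu) y)
  = q ^ (m%:Z * M) * qbinom m p%:Z.
Proof.
elim: m p => [|m IH] p.
  by rewrite big_seq1 big_nil mul0r mul1r qbinom0n.
rewrite boxS big_allpairs_dep -sum_qbinom mulr_sumr; apply: eq_bigr => i _ /=.
under eq_bigr do rewrite big_cons expfzDr ?q_neq0 //.
rewrite -mulr_sumr IH [LHS]mulrA [RHS]mulrA -[q ^+ i]/(q ^ i%:Z).
rewrite -!expfzDr ?q_neq0 //; congr (q ^ _ * _).
by rewrite intS mulrDl mul1r; ring.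
Qed.

(** If [p < M], only the empty tuple survives, and only for [m = 0]; this matches the value of
    [qbinom] at a negative argument. *)
Definition quasi_enum (M p : int) (m : nat) : seq (seq int) :=
  if p - M is Posz k then box M m k else nseq (m == 0)%N [::].

Lemma quasi_enum_uniq M p m : uniq (quasi_enum M p m).
Proof. by rewrite /quasi_enum; case: (p - M) => k; rewrite ?box_uniq //; case: m. Qed.

Lemma quasi_enumP M p m mu :
  reflect (quasipartition M p m mu) (mu \in quasi_enum M p m).
Proof.
rewrite /quasi_enum /quasipartition.
case E : (p - M) => [k|k].
  have -> : p = M + k%:Z by lia.
  rewrite mem_box; apply: (iffP andP) => [[/eqP-> ->]|[Hs H]]; first by [].
  split; first by rewrite Hs.
  (* For [m = 0] a quasipartition carries no path condition, but [box] asks for [M <= M + k], which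
     holds since [k] is natural. *)
  case: m Hs H => [/size0nil-> _|m _]; last exact.
  by rewrite /= lerDl.
rewrite mem_nseq; case: m => [|m] /=.
  by apply: (iffP eqP) => [->|[/size0nil->]].
constructor=> -[_ /(_ isT)]; rewrite rcons_path => /andP[Hp Hl].
by have := le_trans Hl (path_ge_last Hp); lia.
Qed.

Lemma sum_quasi_enum M p m :
  \sum_(mu <- quasi_enum M p m) q ^ (\sum_(y <- mu) y)
  = q ^ (m%:Z * M) * qbinom m (p - M).
Proof.
rewrite /quasi_enum; case: (p - M) => k; first exact: sum_box.
case: m => [|m] /=; last by rewrite big_nil mulr0.
by rewrite big_seq1 big_nil mul0r mulr1.
Qed.

(** * Functions with prescribed values on a finite support *)

Section FinitelySupportedFunctions.
Variables (T : eqType) (V : choiceType) (v0 : V) (Q : T -> seq V).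

(** Fixing the value [v0] off [s] makes the list finite although [T] may be infinite. *)
Fixpoint pi_seq (s : seq T) : seq (T -> V) :=
  if s is x :: s'
  then [seq (fun y => if y == x then v else f y) | v <- Q x, f <- pi_seq s']
  else [:: fun=> v0].

Lemma mem_pi_seq s f : uniq s ->
  f \in pi_seq s <-> forall x, if x \in s then f x \in Q x else f x == v0.
Proof.
elim: s f => [|x s IH] f /=.
  by rewrite inE => _; split=> [/eqP->//|H]; apply/eqP/funext => x; apply/eqP/H.
case/andP=> xs us; split.
  case/allpairsPdep => v [g [Qv /IH -/(_ us) Hg ->]] y.
  rewrite inE; have [->//|_] := eqVneq y x.
  exact: Hg.
move=> Hf; apply/allpairsPdep; exists (f x), (fun y => if y == x then v0 else f y).
split; first by have := Hf x; rewrite mem_head.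
  apply/IH => // y; have := Hf y; rewrite inE.
  by have [->|//] := eqVneq y x; rewrite (negPf xs).
by apply/funext => y; case: eqVneq => [->|].
Qed.

Lemma pi_seq_uniq s : uniq s -> (forall x, uniq (Q x)) -> uniq (pi_seq s).
Proof.
move=> + UQ; elim: s => //= x s IH /andP[xs us].
apply: allpairs_uniq_dep => //; first by move=> v _; exact: IH.
move=> [v f] [w g] /allpairsPdep -[v' [f' [_ Hf [-> ->]]]].
move=> /allpairsPdep -[w' [g' [_ Hg [-> ->]]]] /= E.
have -> : v' = w' by have := congr1 (@^~ x) E; rewrite /= eqxx.
suff -> : f' = g' by [].
(* The update at [x] hides the values of [f'] and [g'] there, but both equal [v0] because [x] is not
   in [s]. *)
apply/funext => y; have := congr1 (@^~ y) E => /=.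
case: eqVneq => // -> _; move: Hf Hg.
by move=> /mem_pi_seq -/(_ us x) + /mem_pi_seq -/(_ us x); rewrite (negPf xs) => /eqP-> /eqP->.
Qed.

Lemma sum_pi_seq (R : comPzSemiRingType) (F : T -> V -> R) s : uniq s ->
  \sum_(f <- pi_seq s) \prod_(x <- s) F x (f x)
  = \prod_(x <- s) \sum_(v <- Q x) F x v.
Proof.
elim: s => [|x s IH] /=; first by rewrite big_seq1 !big_nil.
case/andP=> xs us; rewrite big_allpairs_dep big_cons -IH // mulr_suml.
apply: eq_bigr => v _; rewrite mulr_sumr; apply: eq_bigr => f _.
rewrite big_cons eqxx; congr (_ * _); apply: eq_big_seq => y ys.
by case: eqVneq ys xs => // -> ->.
Qed.

End FinitelySupportedFunctions.

(** * Inclusion-exclusion signs *)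

Lemma sum_nonempty_subsets_sign (T : finType) (R : comPzRingType) (D : {set T}) :
  D != finset.set0 ->
  \sum_(S : {set T} | (S != finset.set0) && (S \subset D)) (-1) ^+ (#|S| + 1) = 1 :> R.
Proof.
case/set0Pn=> t0 tD.
have : \sum_(S : {set T} | S \subset D) (-1) ^+ #|S| = 0 :> R.
  (* Expand the product over all [t] of $1-\chi(t\in D)$: it vanishes because of the factor at [t0],
     and the terms of subsets not inside [D] are zero. *)
  have := @bigA_distr R 0 1 *%R +%R T (fun t => if t \in D then -1 else 0) (fun=> 1).
  rewrite (bigD1 t0) //= tD addNr mul0r => zE; rewrite [RHS]zE.
  rewrite big_mkcond; apply: eq_bigr => S _; case: ifP => [SD|/negP SD].
    rewrite -prodr_const big_mkcond; apply: eq_bigr => t _.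
    by case: ifP => // /(fintype.subsetP SD) ->.
  have /fintype.subsetPn[t tS tD'] : ~~ (S \subset D) by apply/negP.
  by rewrite (bigD1 t) //= tS (negPf tD') mul0r.
rewrite (bigD1 finset.set0) ?finset.sub0set //= cards0 expr0 => /eqP.
rewrite addr_eq0 => /eqP oneE; rewrite [RHS]oneE -sumrN; apply: eq_big => S.
  by rewrite andbC.
by rewrite addn1 exprS mulN1r.
Qed.

(** * Riggings of a fixed configuration *)

Section Riggings.
Variable n : nat.

Lemma MS_leP (lam : n.-tuple nat) (S : {set filling lam}) (h : H n) (x : int) :
  S != finset.set0 ->
  reflect (forall t, t \in S -> Mt t h <= x) (MS S h <= x).
Proof.
move=> S0; apply: (iffP idP); rewrite /MS.
  case: pickP => [t0 t0S /bigmax_leP[_]//|S_ _ t]; by rewrite S_.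
case: pickP => [t0 t0S H|S_]; last by case/set0Pn: S0 => t; rewrite S_.
by apply/bigmax_leP; split => //; apply: H.
Qed.

(** The lower bound is compared only with the last part, so satisfying all the bounds [Mt t h]
    amounts to satisfying their maximum. *)
Lemma quasipartition_MS (lam : n.-tuple nat) (S : {set filling lam}) (h : H n)
    (p : int) (m : nat) (mu : seq int) :
  S != finset.set0 ->
  quasipartition (MS S h) p m mu
  <-> (forall t, t \in S -> quasipartition (Mt t h) p m mu).
Proof.
move=> S0; split=> [[Hs Hp] t tS|Hq].
  split=> // /Hp; rewrite !rcons_path => /andP[-> /(MS_leP _ _ S0)]; exact.
have /set0Pn[t0 t0S] := S0; have [Hs Hp0] := Hq _ t0S.
split=> // m0; have := Hp0 m0; rewrite !rcons_path => /andP[-> _] /=.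
apply/MS_leP => // t /Hq[_ /(_ m0)].
by rewrite rcons_path => /andP[].
Qed.

(** Off this support a rigging is forced to be empty and its factor in the generating function is
    1. *)
Definition mult_supp (nu : configuration n) : seq (H n) :=
  fset_set [set h : H n | mult nu h != 0%N]%classic.

Lemma mem_mult_supp nu h : (h \in mult_supp nu) = (mult nu h != 0%N).
Proof.
transitivity (h \in [set h | mult nu h != 0%N]%classic).
  exact: (in_fset_set (mult_finite nu) h).
by apply/idP/idP; rewrite inE.
Qed.

Lemma fsbig_mult_supp (R : Type) (idx : R) (op : Monoid.com_law idx)
    (nu : configuration n) (f : H n -> R) :
  (forall h, mult nu h = 0%N -> f h = idx) ->
  \big[op/idx]_(h \in [set: H n]%classic) f h
  = \big[op/idx]_(h <- mult_supp nu) f h.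
Proof.
move=> Hf; rewrite [RHS]fsbig_seq ?fset_uniq //; apply/esym/fsbig_widen => //.
move=> h [_ /= Hh]; apply: Hf; apply/eqP/negPn/negP.
by rewrite -mem_mult_supp.
Qed.

Definition riggings (M p : H n -> int) (nu : configuration n) : seq (rigging n) :=
  pi_seq [::] (fun h => quasi_enum (M h) (p h) (mult nu h)) (mult_supp nu).

Lemma riggingsP M p nu J :
  J \in riggings M p nu
  <-> forall h, quasipartition (M h) (p h) (mult nu h) (J h).
Proof.
rewrite mem_pi_seq ?fset_uniq //; split=> HJ h; have := HJ h.
  rewrite mem_mult_supp; case: eqVneq => [-> /eqP ->|_ /quasi_enumP //].
  by split.
rewrite mem_mult_supp; case: eqVneq => [-> [/size0nil -> //]|_ /quasi_enumP //].
Qed.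

Lemma riggings_uniq M p nu : uniq (riggings M p nu).
Proof. by apply: pi_seq_uniq; rewrite ?fset_uniq // => h; exact: quasi_enum_uniq. Qed.

Lemma expq_sum (I : Type) (r : seq I) (f : I -> int) :
  q ^ (\sum_(i <- r) f i) = \prod_(i <- r) q ^ f i.
Proof. by rewrite (big_morph _ (fun x y => expfzDr x y q_neq0) (expr0z q)). Qed.

(** The parts at different [h] are chosen independently, so the sum factors over the support into
    the one-index sums of [sum_quasi_enum]. *)
Lemma sum_riggings M p nu :
  \sum_(J <- riggings M p nu) q ^ (\sum_(h \in [set: H n]) \sum_(y <- J h) y)
  = q ^ (\sum_(h \in [set: H n]) (mult nu h)%:Z * M h)
    * \big[*%R/1]_(h \in [set: H n]%classic) qbinom (mult nu h) (p h - M h).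
Proof.
rewrite (@fsbig_mult_supp _ _ _ nu); last by move=> h ->; rewrite mul0r.
rewrite (@fsbig_mult_supp _ _ _ nu); last by move=> h ->; rewrite qbinom0n.
rewrite expq_sum -big_split /=.
under [RHS]eq_bigr do rewrite -sum_quasi_enum.
rewrite -(sum_pi_seq [::]) ?fset_uniq //.
apply: eq_big_seq => J /riggingsP HJ.
rewrite (@fsbig_mult_supp _ _ _ nu) ?expq_sum // => h m0.
by have [] := HJ h; rewrite m0 => /size0nil-> _; rewrite big_nil.
Qed.

End Riggings.

(** * The inclusion-exclusion formula *)

Theorem mainTheorem3 (n : nat) (hn : (2 <= n)%N) (B : seq (H n))
    (lam : n.-tuple nat) :
  let L := multiplicity_array B in
  RCpoly L lam =
  \sum_(S in SA lam) (-1) ^+ (#|S| + 1) *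
    \sum_(nu \in C L lam)
      q ^ (cc nu + \sum_(h \in [set: H n]%classic) (mult nu h)%:Z * MS S h) *
      \big[*%R/1]_(h \in [set: H n]%classic)
        qbinom (mult nu h) (vacancy L nu h - MS S h).
Proof.
move=> L; rewrite /RCpoly fsbig_finite; last exact: RC_finite.
(* The fillings that allow the rigging of [x]; over an admissible configuration, membership in [RC]
   means that [D x] is nonempty. *)
pose D (x : configuration n * rigging n) := [set t in A lam |
  `[< forall h, quasipartition (Mt t h) (vacancy L x.1 h) (mult x.1 h) (x.2 h) >]]%SET.
have DA x : D x \subset A lam.
  by apply/fintype.subsetP => t; rewrite inE => /andP[].
have mem_RC x : x \in fset_set (RC L lam) = `[< C L lam x.1 >] && (D x != finset.set0).
  rewrite in_fset_set; last exact: RC_finite.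
  apply/idP/andP; rewrite inE.
    move=> [HC [t tA Ht]]; split; first exact/asboolP.
    by apply/set0Pn; exists t; rewrite inE tA; apply/asboolP.
  case=> /asboolP HC /set0Pn[t]; rewrite inE => /andP[tA /asboolP Ht].
  by split=> //; exists t.
(* Multiply each term by the signed sum over nonempty subsets of [D x], which is 1; these are the
   members of [SA] inside [D x]. *)
transitivity (\sum_(x <- fset_set (RC L lam)) \sum_(S in SA lam)
    (-1) ^+ (#|S| + 1) * (if S \subset D x then q ^ ccJ x else 0)).
  apply: eq_big_seq => x; rewrite mem_RC => /andP[_ Dx].
  rewrite -[LHS]mul1r -[X in X * _ = _](sum_nonempty_subsets_sign Kq Dx) mulr_suml.
  rewrite big_mkcond [RHS]big_mkcond; apply: eq_bigr => S _.
  rewrite !inE; case: (S != finset.set0) => //=.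
  have [SD|] := boolP (S \subset D x); last by rewrite mulr0 if_same.
  by rewrite (fintype.subset_trans SD (DA x)).
rewrite exchange_big; apply: eq_bigr => S; rewrite inE => /andP[S0 SA].
rewrite -mulr_sumr; congr (_ * _).
rewrite -big_mkcond -big_filter fsbig_finite; last exact: C_finite.
under [RHS]eq_bigr => nu _.
  rewrite expfzDr ?q_neq0 // -mulrA -sum_riggings mulr_sumr.
  under eq_bigr do rewrite -expfzDr ?q_neq0 //.
  over.
(* For fixed [S], the [x] in [RC] with [S] inside [D x] are exactly the pairs whose rigging has
   lower bounds [MS S]. *)
pose s := [seq (nu, J) | nu <- fset_set (C L lam), J <- riggings (MS S) (vacancy L nu) nu].
transitivity (\sum_(x <- s) q ^ ccJ x); last by rewrite big_allpairs_dep.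
apply: perm_big; apply: uniq_perm; first by rewrite filter_uniq ?fset_uniq.
  apply: allpairs_uniq_dep; rewrite ?fset_uniq //.
    by move=> nu _; exact: riggings_uniq.
  by move=> [nu J] [nu' J'] _ _ [-> ->].
move=> [nu J]; rewrite mem_filter mem_RC /=.
apply/idP/allpairsPdep => [/and3P[SD /asboolP HC _]|].
  exists nu, J; split=> //; first by rewrite in_fset_set ?inE //; exact: C_finite.
  apply/riggingsP => h; apply/quasipartition_MS => // t /(fintype.subsetP SD).
  by rewrite inE => /andP[_ /asboolP]; apply.
case=> nu' [J' [HC HJ [nuE JE]]]; move: HC HJ; rewrite -nuE -JE.
rewrite in_fset_set ?inE; last exact: C_finite.
move=> HC /riggingsP HJ.
have SD : S \subset D (nu, J).
  apply/fintype.subsetP => t tS; rewrite inE (fintype.subsetP SA) //=; apply/asboolP => h.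
  by have /quasipartition_MS -/(_ S0) := HJ h; apply.
rewrite SD /=; apply/andP; split; first exact/asboolP.
(* [D (nu, J)] contains the nonempty [S], so the pair does lie in [RC]. *)
by apply: contra_neq S0 => D0; apply/eqP; rewrite -finset.subset0 -D0.
Qed.
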